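(* The space $L_r(\ell_0^\infty,\ell_0^\infty)$ is not majorizing in $L_r(\ell_0^\infty,\ell^\infty)$, and therefore it is not order dense in $L_r(\ell_0^\infty,\ell^\infty)$.
   Context: $\ell^\infty$ is the vector lattice of all bounded real sequences $(x_i)_{i\in\mathbb{N}}$ with the pointwise order, and $\ell_0^\infty=\{(x_i)_{i\in\mathbb{N}} : \exists c\in\mathbb{R}\ \exists k\in\mathbb{N}\ \forall i\ge k\colon x_i=c\}$ is its vector sublattice of eventually constant sequences, with the pointwise order. ($\ell^\infty$ is the Dedekind completion of $\ell_0^\infty$.) For ordered vector spaces $X,Z$ with $X$ directed (any two elements have a common upper bound), a linear operator $T\colon X\to Z$ is positive if $T(X_+)\subseteq Z_+$, and regular if it is a difference of two positive linear operators. $L_r(X,Z)$ is the space of all regular operators, ordered by $S\le T$ iff $T-S$ is positive. Via the inclusion $\ell_0^\infty\subseteq\ell^\infty$, $L_r(\ell_0^\infty,\ell_0^\infty)$ is regarded as a linear subspace of $L_r(\ell_0^\infty,\ell^\infty)$. A linear subspace $D$ of an ordered vector space $X$ is majorizing in $X$ if for every $x\in X$ there is $d\in D$ with $x\le d$. It is order dense in $X$ if for every $x\in X$ the infimum of $\{z\in D : x\le z\}$ exists in $X$ and equals $x$. *)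

(* Defs.v *)
From HB Require Import structures.
From mathcomp Require Import all_boot all_order all_algebra.
From mathcomp Require Import boolp classical_sets functions reals.
From mathcomp Require Import topology normedtype.

Set Implicit Arguments.
Unset Strict Implicit.
Unset Printing Implicit Defensive.

Import Order.TTheory GRing.Theory Num.Theory.
Import numFieldNormedType.Exports.

Local Open Scope classical_set_scope.
Local Open Scope ring_scope.

HB.mixin Record POrderedLmodule_isOrdered (R : realDomainType) V
    of GRing.Lmodule R V & Num.POrderedZmodule V := {
  lev_wD2r : forall z x y : V, x <= y -> x + z <= y + z;
  scalev_ge0 : forall (a : R) (x : V), 0 <= a -> 0 <= x -> 0 <= a *: x
}.

#[short(type="orderedLmodType")]
HB.structure Definition OrderedLmodule (R : realDomainType) :=
  { V of GRing.Lmodule R V & Num.POrderedZmodule V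
       & POrderedLmodule_isOrdered R V }.

HB.mixin Record OrderedLmodule_isDirected (R : realDomainType) V
    of OrderedLmodule R V := {
  directed_ub : forall x y : V, exists z : V, x <= z /\ y <= z
}.

#[short(type="directedLmodType")]
HB.structure Definition DirectedLmodule (R : realDomainType) :=
  { V of OrderedLmodule R V & OrderedLmodule_isDirected R V }.

Section OrderedLmoduleTheory.
Context {R : realDomainType} {V : orderedLmodType R}.
Implicit Types (x y : V) (D : set V).

Lemma subv_ge0 x y : (0 <= y - x) = (x <= y).
Proof.
apply/idP/idP => [/(lev_wD2r x)|/(lev_wD2r (- x))].
  by rewrite add0r subrK.
by rewrite subrr.
Qed.

Lemma addv_ge0 x y : 0 <= x -> 0 <= y -> 0 <= x + y.
Proof. by move=> x0 /(lev_wD2r x); rewrite add0r addrC; exact: le_trans. Qed.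

Definition majorizing D := forall x, exists2 d, D d & x <= d.

Definition order_dense D := forall x, infimums [set z | D z /\ x <= z] x.

End OrderedLmoduleTheory.

Definition positive_op (R : realDomainType) (X Z : orderedLmodType R)
  (T : X -> Z) := forall x, 0 <= x -> 0 <= T x.

Section RegularOperators.
Context {R : realDomainType}.
Variables (X : directedLmodType R) (Z : orderedLmodType R).

Definition is_regular (T : X -> Z) := exists P N : {linear X -> Z},
  [/\ positive_op P, positive_op N & T = P \- N].

Definition regular : {pred X -> Z} := fun T => `[< is_regular T >].

Lemma regularP T : reflect (is_regular T) (T \in regular).
Proof. exact: asboolP. Qed.

Lemma regular_submod_closed : submod_closed regular.
Proof.
split.
  apply/regularP; exists \0, \0; split=> //.
  by apply/funext => x /=; rewrite subrr.
move=> a f g /regularP[P [N [P0 N0 ->]]] /regularP[P' [N' [P'0 N'0 ->]]].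
apply/regularP; have [a0|/ltW a0] := leP 0 a.
  exists (a \*: P \+ P'), (a \*: N \+ N'); split=> [x x0|x x0|] /=.
  - by apply: addv_ge0; [apply: scalev_ge0 => //; exact: P0|exact: P'0].
  - by apply: addv_ge0; [apply: scalev_ge0 => //; exact: N0|exact: N'0].
  - by apply/funext => x; rewrite /= fctE /= scalerBr opprD addrACA.
have na0 : 0 <= - a by rewrite oppr_ge0.
exists ((- a) \*: N \+ P'), ((- a) \*: P \+ N'); split=> [x x0|x x0|] /=.
- by apply: addv_ge0; [apply: scalev_ge0 => //; exact: N0|exact: P'0].
- by apply: addv_ge0; [apply: scalev_ge0 => //; exact: P0|exact: N'0].
- apply/funext => x.
  rewrite -[LHS]/(a *: (P x - N x) + (P' x - N' x)) /=.
  by rewrite scalerBr opprD !scaleNr opprK [RHS]addrACA (addrC (a *: P x)).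
Qed.

HB.instance Definition _ :=
  GRing.isSubmodClosed.Build R (X -> Z) regular regular_submod_closed.

(* The space L_r(X, Z); linearity of its elements follows from [is_regular]. *)
Record regop := Regop { regop_fun :> X -> Z; _ : regop_fun \in regular }.

HB.instance Definition _ := [isSub for regop_fun].
HB.instance Definition _ := [Choice of regop by <:].
HB.instance Definition _ := [SubChoice_isSubLmodule of regop by <:].

Lemma regop_is_linear (T : regop) : linear T.
Proof.
have /regularP[P [N [_ _ TE]]] := valP T.
move=> a x y; rewrite /= TE -[RHS]/(a *: (P x - N x) + (P y - N y)) /=.
rewrite -[LHS]/(P (a *: x + y) - N (a *: x + y)).
by rewrite (linearP P) (linearP N) scalerBr opprD addrACA.
Qed.

HB.instance Definition _ (T : regop) :=
  GRing.isLinear.Build R X Z _ T (regop_is_linear T).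

Lemma regopBE (S T : regop) x : (T - S) x = T x - S x.
Proof. by []. Qed.

Definition regop_le (S T : regop) := `[< positive_op (T - S) >].

Lemma regop_le_refl : reflexive regop_le.
Proof. by move=> T; apply/asboolP => x _; rewrite subrr. Qed.

(* Antisymmetry is where directedness of [X] is needed. *)
Lemma regop_le_anti : antisymmetric regop_le.
Proof.
move=> S T /andP[/asboolP ST /asboolP TS].
have ST_ge0 x : 0 <= x -> S x = T x.
  move=> x0; have := ST x x0; have := TS x x0.
  rewrite !regopBE !subv_ge0 => TSx STx.
  by apply: (@le_anti _ Z); rewrite STx TSx.
apply/val_inj/funext => x /=; have [z [xz z0]] := directed_ub x 0.
have := ST_ge0 (z - x); rewrite subv_ge0 => /(_ xz).
by rewrite (linearB S) (linearB T) /= (ST_ge0 z z0) => /addrI/oppr_inj.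
Qed.

Lemma regop_le_trans : transitive regop_le.
Proof.
move=> T S U /asboolP ST /asboolP TU; apply/asboolP => x x0.
by rewrite -(subrK T U) -addrA; apply: addv_ge0; [exact: TU|exact: ST].
Qed.

HB.instance Definition _ := Order.Le_isPOrder.Build ring_display regop
  regop_le_refl regop_le_anti regop_le_trans.

Lemma regop_leP (S T : regop) : reflect (positive_op (T - S)) (S <= T).
Proof. exact: asboolP. Qed.

Lemma regop_lev_wD2r (U S T : regop) : S <= T -> S + U <= T + U.
Proof. by move/regop_leP => ST; apply/regop_leP; rewrite opprD addrACA subrr addr0. Qed.

Lemma regop_scalev_ge0 (a : R) (T : regop) : 0 <= a -> 0 <= T -> 0 <= a *: T.
Proof.
move=> a0 /regop_leP; rewrite subr0 => T0; apply/regop_leP; rewrite subr0.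
by move=> x x0; apply: scalev_ge0 => //; exact: T0.
Qed.

HB.instance Definition _ := POrderedLmodule_isOrdered.Build R regop
  regop_lev_wD2r regop_scalev_ge0.

End RegularOperators.

Notation "''L_r' ( X , Z )" := (regop X Z) (format "''L_r' ( X ,  Z )").

Section SequenceSpaces.
Variable R : realType.

Definition bounded_seq : {pred nat -> R} := fun x => `[< bounded_fun x >].

Lemma bounded_seqP x :
  reflect (exists M, forall i, `|x i| <= M) (x \in bounded_seq).
Proof.
have PF : ProperFilter (globally [set: nat]).
  exact: (@globally_properfilter _ _ 0%N).
apply: (iffP (asboolP _)); rewrite /= ex_bound => -[M xM]; exists M.
  by move=> i; exact: xM.
by move=> i _; exact: xM.
Qed.

Lemma bounded_seq_submod_closed : submod_closed bounded_seq.
Proof.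
split; first by apply/bounded_seqP; exists 0 => i; rewrite normr0.
move=> a x y /bounded_seqP[M xM] /bounded_seqP[N yN].
apply/bounded_seqP; exists (`|a| * M + N) => i.
rewrite (le_trans (ler_normD _ _))// lerD// normrM.
by rewrite ler_wpM2l.
Qed.

HB.instance Definition _ :=
  GRing.isSubmodClosed.Build R (nat -> R) bounded_seq bounded_seq_submod_closed.

Record linfty := Linfty
  { linfty_seq :> nat -> R; _ : linfty_seq \in bounded_seq }.

HB.instance Definition _ := [isSub for linfty_seq].
HB.instance Definition _ := [Choice of linfty by <:].
HB.instance Definition _ := [SubChoice_isSubLmodule of linfty by <:].
(* The order inherited from [nat -> R], i.e. the pointwise one. *)
HB.instance Definition _ :=
  [SubChoice_isSubPOrder of linfty by <: with ring_display].

Lemma linfty_leP (x y : linfty) : reflect (forall i, x i <= y i) (x <= y).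
Proof. exact: asboolP. Qed.

Lemma linfty_lev_wD2r (z x y : linfty) : x <= y -> x + z <= y + z.
Proof. by move=> /linfty_leP xy; apply/linfty_leP => i; rewrite lerD2r. Qed.

Lemma linfty_scalev_ge0 (a : R) (x : linfty) : 0 <= a -> 0 <= x -> 0 <= a *: x.
Proof.
by move=> a0 /linfty_leP x0; apply/linfty_leP => i; rewrite mulr_ge0// x0.
Qed.

HB.instance Definition _ := POrderedLmodule_isOrdered.Build R linfty
  linfty_lev_wD2r linfty_scalev_ge0.

Definition eventually_constant : {pred nat -> R} :=
  fun x => `[< exists (c : R) (k : nat), forall i, (k <= i)%N -> x i = c >].

Lemma eventually_constantP x :
  reflect (exists (c : R) (k : nat), forall i, (k <= i)%N -> x i = c)
          (x \in eventually_constant).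
Proof. exact: asboolP. Qed.

Lemma eventually_constant_submod_closed : submod_closed eventually_constant.
Proof.
split; first by apply/eventually_constantP; exists 0, 0.
move=> a x y /eventually_constantP[c [k xc]] /eventually_constantP[d [l yd]].
apply/eventually_constantP; exists (a * c + d), (maxn k l) => i.
by rewrite geq_max => /andP[ki li]; rewrite !fctE xc// yd.
Qed.

HB.instance Definition _ := GRing.isSubmodClosed.Build R (nat -> R)
  eventually_constant eventually_constant_submod_closed.

Record linfty0 := Linfty0
  { linfty0_seq :> nat -> R; _ : linfty0_seq \in eventually_constant }.

HB.instance Definition _ := [isSub for linfty0_seq].
HB.instance Definition _ := [Choice of linfty0 by <:].
HB.instance Definition _ := [SubChoice_isSubLmodule of linfty0 by <:].
HB.instance Definition _ :=
  [SubChoice_isSubPOrder of linfty0 by <: with ring_display].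

Lemma linfty0_leP (x y : linfty0) : reflect (forall i, x i <= y i) (x <= y).
Proof. exact: asboolP. Qed.

Lemma linfty0_lev_wD2r (z x y : linfty0) : x <= y -> x + z <= y + z.
Proof. by move=> /linfty0_leP xy; apply/linfty0_leP => i; rewrite lerD2r. Qed.

Lemma linfty0_scalev_ge0 (a : R) (x : linfty0) :
  0 <= a -> 0 <= x -> 0 <= a *: x.
Proof.
by move=> a0 /linfty0_leP x0; apply/linfty0_leP => i; rewrite mulr_ge0// x0.
Qed.

HB.instance Definition _ := POrderedLmodule_isOrdered.Build R linfty0
  linfty0_lev_wD2r linfty0_scalev_ge0.

Lemma linfty0_directed (x y : linfty0) : exists z : linfty0, x <= z /\ y <= z.
Proof.
have zP : (fun i => Num.max (x i) (y i)) \in eventually_constant.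
  have /eventually_constantP[c [k xc]] := valP x.
  have /eventually_constantP[d [l yd]] := valP y.
  apply/eventually_constantP; exists (Num.max c d), (maxn k l) => i.
  by rewrite geq_max => /andP[ki li]; rewrite xc// yd.
exists (Linfty0 zP).
by split; apply/linfty0_leP => i /=; rewrite le_max lexx ?orbT.
Qed.

HB.instance Definition _ :=
  OrderedLmodule_isDirected.Build R linfty0 linfty0_directed.

Lemma eventually_constant_bounded (x : nat -> R) :
  x \in eventually_constant -> x \in bounded_seq.
Proof.
move=> /eventually_constantP[c [k xc]]; apply/bounded_seqP.
exists (`|c| + \sum_(j < k) `|x j|) => i; have [ki|ik] := leqP k i.
  by rewrite xc// lerDl sumr_ge0.
by rewrite (bigD1 (Ordinal ik))//= addrCA lerDl addr_ge0// sumr_ge0.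
Qed.

Definition linfty0_incl (x : linfty0) : linfty :=
  Linfty (eventually_constant_bounded (valP x)).

Lemma linfty0_incl_linear : linear linfty0_incl.
Proof. by move=> a x y; exact: val_inj. Qed.

HB.instance Definition _ :=
  GRing.isLinear.Build R linfty0 linfty _ linfty0_incl linfty0_incl_linear.

Lemma linfty0_incl_regular (T : 'L_r(linfty0, linfty0)) :
  (linfty0_incl \o T) \in @regular R linfty0 linfty.
Proof.
have /regularP[P [N [P0 N0 TE]]] := valP T.
apply/regularP; exists (linfty0_incl \o P), (linfty0_incl \o N); split.
- by move=> x /P0/linfty0_leP Px; apply/linfty_leP.
- by move=> x /N0/linfty0_leP Nx; apply/linfty_leP.
- by apply/funext => x; rewrite /= TE /= linearB.
Qed.

(* The linear injection identifying L_r(linfty0, linfty0) with a subspace of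
   L_r(linfty0, linfty): its range consists of the operators that are
   differences of positive operators with values in linfty0. *)
Definition regop_incl (T : 'L_r(linfty0, linfty0)) : 'L_r(linfty0, linfty) :=
  Regop (linfty0_incl_regular T).

Lemma regop_incl_linear : linear regop_incl.
Proof.
by move=> a S T; apply/val_inj/funext => x; exact: val_inj.
Qed.

Lemma regop_incl_inj : injective regop_incl.
Proof.
move=> S T /(congr1 val) ST; apply/val_inj/funext => x; apply: val_inj.
by have /(congr1 val) := congr1 (fun f => f x) ST.
Qed.

HB.instance Definition _ := GRing.isLinear.Build R
  'L_r(linfty0, linfty0) 'L_r(linfty0, linfty) _ regop_incl regop_incl_linear.

End SequenceSpaces.

(* Main.v *)
(** The pullback [T x = x \o f] along a map [f : nat -> nat] all of whose fibres
are infinite is a positive operator from [linfty0] to [linfty].  If it were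
dominated by [S : linfty0 -> linfty0], each [S e_j] would be eventually constant
and at least [1] on the infinite fibre of [j], hence eventually at least [1].
Since [e_0 + ... + e_(n-1) <= 1] and [S] is positive, the eventual value of
[S 1] would be at least [n] for every [n]. *)

Require Import Defs.
From HB Require Import structures.
From mathcomp Require Import all_boot all_order all_algebra.
From mathcomp Require Import boolp classical_sets functions reals.
Local Open Scope classical_set_scope.

Set Implicit Arguments.
Unset Strict Implicit.
Unset Printing Implicit Defensive.

Import Order.TTheory GRing.Theory Num.Theory.
Local Open Scope ring_scope.

(* If no element of [D] dominates [x], then [x] is an infimum of the empty set,
   hence the top element, so [x + x <= x] and [x] is dominated by [0] after all. *)
Lemma order_dense_majorizing (R : realDomainType) (V : orderedLmodType R)
  (D : set V) : D 0 -> order_dense D -> majorizing D.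
Proof.
move=> D0 Ddense x; apply: contrapT => noub.
have [_ x_top] := Ddense x.
have /x_top : lbound [set z | D z /\ x <= z] (x + x).
  by move=> z [Dz xz]; exfalso; apply: noub; exists z.
move=> /(lev_wD2r (- x)); rewrite addrK subrr => x0.
by apply: noub; exists 0.
Qed.

Section Pullback.
Variables (R : realType) (f : nat -> nat).

Lemma pullback_bounded (x : linfty0 R) : x \o f \in @bounded_seq R.
Proof.
have /bounded_seqP[M xM] := eventually_constant_bounded (valP x).
by apply/bounded_seqP; exists M => i; exact: xM.
Qed.

Definition pullback (x : linfty0 R) : linfty R := Linfty (pullback_bounded x).

Lemma pullback_is_linear : linear pullback.
Proof. by move=> a x y; exact: val_inj. Qed.

HB.instance Definition _ := GRing.isLinear.Build R (linfty0 R) (linfty R) _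
  pullback pullback_is_linear.

Lemma pullback_regular : (pullback : _ -> _) \in @regular R (linfty0 R) (linfty R).
Proof.
apply/regularP; exists pullback, \0; split=> //.
  by move=> x /linfty0_leP x0; apply/linfty_leP => i; exact: x0.
by apply/funext => x; rewrite -[RHS]/(pullback x - 0) subr0.
Qed.

Definition pullback_regop : 'L_r(linfty0 R, linfty R) := Regop pullback_regular.

Lemma pullback_regop_leP (S : 'L_r(linfty0 R, linfty0 R)) :
  pullback_regop <= regop_incl S ->
  forall x : linfty0 R, 0 <= x -> forall i, x (f i) <= S x i.
Proof.
by move=> /regop_leP TS x /TS; rewrite regopBE subv_ge0 => /linfty_leP.
Qed.

End Pullback.

Section InitialSegments.
Variable R : realType.

Lemma initial_segment_eventually_constant n :
  (fun i => (i < n)%:R) \in @eventually_constant R.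
Proof.
by apply/eventually_constantP; exists 0, n => i ni; rewrite ltnNge ni.
Qed.

(** The sum [e_0 + ... + e_(n-1)] as a single indicator, so that consecutive differences are unit
    vectors. *)
Definition initial_segment n : linfty0 R :=
  Linfty0 (initial_segment_eventually_constant n).

Lemma one_eventually_constant : (fun=> 1) \in @eventually_constant R.
Proof. by apply/eventually_constantP; exists 1, 0. Qed.

Definition linfty0_one : linfty0 R := Linfty0 one_eventually_constant.

Lemma initial_segment_le_one n : initial_segment n <= linfty0_one.
Proof. by apply/linfty0_leP => i /=; rewrite lern1 leq_b1. Qed.

Lemma initial_segment_leS n : initial_segment n <= initial_segment n.+1.
Proof.
by apply/linfty0_leP => i /=; rewrite ler_nat ltnS; case: ltnP => // /ltnW ->.
Qed.

End InitialSegments.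

Lemma pullback_not_majorized (R : realType) (f : nat -> nat)
    (S : 'L_r(linfty0 R, linfty0 R)) :
  (forall j k, exists2 i, (k <= i)%N & f i = j) ->
  ~ pullback_regop R f <= regop_incl S.
Proof.
move=> f_inf /pullback_regop_leP TS.
have SB (x y : linfty0 R) i : S (x - y) i = S x i - S y i.
  by rewrite (linearB S).
have S_seg n : exists k, forall i, (k <= i)%N -> n%:R <= S (initial_segment R n) i.
  elim: n => [|n [k Sk]].
    exists 0%N => i _; apply: le_trans (TS _ _ i); first by [].
    by apply/linfty0_leP => j; exact: ler0n.
  (* [e] is the unit vector [e_n]. *)
  pose e := initial_segment R n.+1 - initial_segment R n.
  have /eventually_constantP[c [l Sec]] := valP (S e).
  (* The infinite fibre of [n] meets the tail on which [S e] equals [c]; at such an [i], [S e i] is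
     at least [e (f i) = e n = 1]. *)
  have c1 : 1 <= c.
    have [i li fi] := f_inf n l.
    rewrite -(Sec i li); apply: le_trans (TS e _ i); last first.
      by rewrite subv_ge0; exact: initial_segment_leS.
    rewrite fi; change (1 <= (n < n.+1)%:R - (n < n)%:R :> R).
    by rewrite ltnSn ltnn subr0.
  exists (maxn k l) => i; rewrite geq_max => /andP[ki li].
  have := Sec i li; rewrite [LHS]SB => /eqP; rewrite subr_eq => /eqP ->.
  by rewrite -natr1 addrC lerD // Sk.
have /eventually_constantP[c [l Sc]] := valP (S (linfty0_one R)).
(* Compare at an index beyond both thresholds. Positivity of [S] comes from domination: for
   [x >= 0], [S x i] is at least [x (f i) >= 0]; here [x] is
   [linfty0_one R - initial_segment R n]. *)
have c_ge n : n%:R <= c.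
  have [k Sk] := S_seg n; pose i := maxn k l.
  rewrite -(Sc i (leq_maxr _ _)) (le_trans (Sk i (leq_maxl _ _))) // -subr_ge0.
  rewrite -SB; apply: le_trans (TS _ _ i).
    change (0 <= 1 - (f i < n)%:R :> R).
    by rewrite subr_ge0 lern1 leq_b1.
  by rewrite subv_ge0; exact: initial_segment_le_one.
have c0 : 0 <= c := c_ge 0%N.
(* A real above every natural number contradicts the Archimedean property. *)
by have := archi_boundP c0; rewrite ltNge c_ge.
Qed.

(** The factor [3 ^ k] pushes [2 ^ j * 3 ^ k] beyond [k] without changing its 2-adic valuation
    [j]. *)
Lemma logn2_infinite_fibres j k : exists2 i, (k <= i)%N & logn 2 i = j.
Proof.
exists (2 ^ j * 3 ^ k)%N.
  by rewrite (leq_trans (ltnW (ltn_expl k (isT : 1 < 3)%N))) // leq_pmull ?expn_gt0.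
by rewrite lognM ?expn_gt0 // pfactorK // lognX muln0 addn0.
Qed.

Theorem mainTheorem4 (R : realType) :
  let D : set 'L_r(linfty0 R, linfty R) :=
    range (@regop_incl R : 'L_r(linfty0 R, linfty0 R) ->
                           'L_r(linfty0 R, linfty R)) in
  ~ majorizing D /\ ~ order_dense D.
Proof.
move=> D.
have not_maj : ~ majorizing D.
  move=> /(_ (pullback_regop R (logn 2)))[_ [S _ <-]].
  exact: pullback_not_majorized logn2_infinite_fibres.
split=> // D_dense; apply: not_maj; apply: order_dense_majorizing D_dense.
by exists 0 => //; rewrite linear0.
Qed.
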